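(* Let $\Omega=\{\omega_1,\ldots,\omega_n\}$ be an LF-inducing set. If there exists a positive integer $M$ such that $1$ is an element of the set $$\mathcal A(M)=\left\{\prod_{i=1}^n\omega_i^{m_i}: m_i\ge0 \text{ an integer for each } i\in\{1,\ldots,n\},\ \sum_{i=1}^n m_i=M\right\},$$ then $(I_{F_\Omega},\sigma_{F_\Omega})$ and $(I^+_{F_\Omega},\sigma^+_{F_\Omega})$ do not have the shadowing property.
   Context: $I=[0,1]$. $(r,\rho)\in\mathcal{NC}$ means: $0<r<1<\rho$, and for all integers $k,l$, $r^k=\rho^l$ if and only if $k=l=0$. For an integer $n\ge 2$, a set $\Omega=\{\omega_1,\ldots,\omega_n\}$ of positive real numbers is LF-inducing if $\omega_1<1<\omega_2$ and $(\omega_1,\omega_2)\in\mathcal{NC}$. For such $\Omega$, $F_\Omega=\bigcup_{j=1}^n\{(x,y)\in I^2: y=\omega_j x\}$. For a closed relation $F\subseteq I\times I$: $I_F^+=\{(x_1,x_2,\ldots)\in I^{\mathbb N}: (x_i,x_{i+1})\in F\ \forall i\ge 1\}$ with shift $\sigma_F^+(x_1,x_2,\ldots)=(x_2,x_3,\ldots)$; $I_F=\{(x_i)_{i\in\mathbb Z}\in I^{\mathbb Z}: (x_i,x_{i+1})\in F\ \forall i\in\mathbb Z\}$ with shift $(\sigma_F(\mathbf x))_i=x_{i+1}$. The metrics are $\sup_{i\ge 1}|x_i-y_i|/2^{i}$ on $I_F^+$ and $\sup_{i\in\mathbb Z}|x_i-y_i|/2^{|i|}$ on $I_F$. Let $(Y,f)$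 be a dynamical system ($Y$ compact metric with metric $d$, $f:Y\to Y$ continuous). For $\delta>0$, a sequence $(x_0,x_1,\ldots)$ in $Y$ is a $\delta$-pseudo-orbit if $d(f(x_k),x_{k+1})<\delta$ for every $k\ge0$. $(Y,f)$ has the shadowing property if for each $\varepsilon>0$ there is $\delta>0$ such that for each $\delta$-pseudo-orbit $(x_k)_{k\ge 0}$ there is $y\in Y$ with $d(f^k(y),x_k)<\varepsilon$ for all $k\ge 0$. *)

(* Defs.v *)
From HB Require Import structures.
From mathcomp Require Import all_boot all_order all_algebra.
From mathcomp Require Import all_classical all_reals all_analysis.

Set Implicit Arguments.
Unset Strict Implicit.
Unset Printing Implicit Defensive.
Import Order.TTheory GRing.Theory Num.Theory.

Local Open Scope classical_set_scope.
Local Open Scope ring_scope.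

Section shadowing.
Context {R : realType} {Y : metricType R}.

Definition pseudo_orbit (f : Y -> Y) (delta : R) (x : nat -> Y) : Prop :=
  forall k, mdist (f (x k)) (x k.+1) < delta.

Definition shadowing_property (f : Y -> Y) : Prop :=
  forall eps : R, 0 < eps -> exists2 delta : R, 0 < delta &
    forall x : nat -> Y, pseudo_orbit f delta x ->
      exists y : Y, forall k, mdist (iter k f y) (x k) < eps.

End shadowing.

(* The supremum is a genuine one, i.e. of a nonempty bounded set, only when   *)
(* J is inhabited and the weighted differences are bounded.                   *)
Section weighted_sup_distance.
Context {R : realType} {J : Type}.
Implicit Types (w x y z : J -> R).

Definition wsup_dist w x y : R := sup (range (fun j => `|x j - y j| / w j)).

Variables (j0 : J) (w : J -> R).
Hypothesis w_ge1 : forall j, 1 <= w j.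

Let I_seq x := forall j, `[0, 1]%classic (x j).

Lemma wsup_dist_ge x y j : I_seq x -> I_seq y ->
  `|x j - y j| / w j <= wsup_dist w x y.
Proof.
move=> Ix Iy; apply: ub_le_sup; last by exists j.
exists 1 => _ [i _ <-]; have w0 : 0 < w i by apply: lt_le_trans (w_ge1 i).
rewrite ler_pdivrMr// mul1r (le_trans _ (w_ge1 i))//.
have := Ix i; have := Iy i; rewrite /= !in_itv/= => /andP[y0 y1] /andP[x0 x1].
rewrite ler_norml lerBlDr (le_trans x1) ?lerDl// andbT.
by rewrite lerBrDr addrC (le_trans _ x0)// subr_le0.
Qed.

Lemma wsup_dist_le x y c :
  (forall j, `|x j - y j| / w j <= c) -> wsup_dist w x y <= c.
Proof.
move=> xyc; apply: ge_sup; first by exists (`|x j0 - y j0| / w j0), j0.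
by move=> _ [j _ <-].
Qed.

Lemma wsup_distxx x : I_seq x -> wsup_dist w x x = 0.
Proof.
move=> Ix; apply/eqP; rewrite eq_le; apply/andP; split.
  by apply: wsup_dist_le => j; rewrite subrr normr0 mul0r.
by have := wsup_dist_ge j0 Ix Ix; rewrite subrr normr0 mul0r.
Qed.

Lemma wsup_dist_sym x y : wsup_dist w x y = wsup_dist w y x.
Proof.
rewrite /wsup_dist; under eq_fun do rewrite distrC.
by [].
Qed.

Lemma wsup_dist_positivity x y : I_seq x -> I_seq y ->
  wsup_dist w x y = 0 -> x = y.
Proof.
move=> Ix Iy xy0; apply/funext => j; apply/eqP.
have w0 : 0 < w j by apply: lt_le_trans (w_ge1 j).
have := wsup_dist_ge j Ix Iy.
by rewrite xy0 ler_pdivrMr// mul0r normr_le0 subr_eq0.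
Qed.

Lemma wsup_dist_triangle y x z : I_seq x -> I_seq y -> I_seq z ->
  wsup_dist w x z <= wsup_dist w x y + wsup_dist w y z.
Proof.
move=> Ix Iy Iz; apply: wsup_dist_le => j.
have w0 : 0 < w j by apply: lt_le_trans (w_ge1 j).
apply: le_trans (lerD (wsup_dist_ge j Ix Iy) (wsup_dist_ge j Iy Iz)).
by rewrite -mulrDl ler_pM2r ?invr_gt0// ler_distD.
Qed.

End weighted_sup_distance.

(* The term x_(i+1) of a one-sided sequence (x_1, x_2, ...) is x i below.     *)
Section one_sided_system.
Context {R : realType} (F : set (R * R)).

Definition fwd_space_set : set (nat -> R) :=
  [set x | (forall i, `[0, 1]%classic (x i)) /\ (forall i, F (x i, x i.+1))].

Definition fwd_space : Type := set_type fwd_space_set.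

HB.instance Definition _ := Choice.on fwd_space.

Implicit Types x y z : fwd_space.

Definition fwd_weight (i : nat) : R := 2 ^+ i.+1.

Definition fwd_dist x y : R := wsup_dist fwd_weight (val x) (val y).

Lemma fwd_weight_ge1 i : 1 <= fwd_weight i.
Proof. by rewrite exprn_ege1// ler1n. Qed.

Lemma fwd_space_I x i : `[0, 1]%classic (val x i).
Proof. by have [] := set_mem (valP x). Qed.

Lemma fwd_distxx x : fwd_dist x x = 0.
Proof. exact: (wsup_distxx 0%N fwd_weight_ge1 (fwd_space_I x)). Qed.

Lemma fwd_dist_positivity x y : fwd_dist x y = 0 -> x = y.
Proof.
move=> xy; apply: val_inj.
exact: (wsup_dist_positivity fwd_weight_ge1 (fwd_space_I x) (fwd_space_I y) xy).
Qed.

Lemma fwd_dist_sym x y : fwd_dist x y = fwd_dist y x.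
Proof. exact: wsup_dist_sym. Qed.

Lemma fwd_dist_triangle y x z : fwd_dist x z <= fwd_dist x y + fwd_dist y z.
Proof.
exact: (wsup_dist_triangle 0%N fwd_weight_ge1
  (fwd_space_I x) (fwd_space_I y) (fwd_space_I z)).
Qed.

HB.instance Definition _ := isMetric.Build R fwd_space
  fwd_distxx fwd_dist_positivity fwd_dist_sym fwd_dist_triangle.

Lemma fwd_shift_subproof x : (fun i => val x i.+1) \in fwd_space_set.
Proof.
have [xI xF] := set_mem (valP x).
by apply/mem_set; split => i; [exact: xI|exact: xF].
Qed.

Definition fwd_shift x : fwd_space := SigSub (fwd_shift_subproof x).

End one_sided_system.

Section two_sided_system.
Context {R : realType} (F : set (R * R)).

Definition bi_space_set : set (int -> R) :=
  [set x | (forall i, `[0, 1]%classic (x i)) /\ (forall i, F (x i, x (i + 1)))].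

Definition bi_space : Type := set_type bi_space_set.

HB.instance Definition _ := Choice.on bi_space.

Implicit Types x y z : bi_space.

Definition bi_weight (i : int) : R := 2 ^+ `|i|%N.

Definition bi_dist x y : R := wsup_dist bi_weight (val x) (val y).

Lemma bi_weight_ge1 i : 1 <= bi_weight i.
Proof. by rewrite exprn_ege1// ler1n. Qed.

Lemma bi_space_I x i : `[0, 1]%classic (val x i).
Proof. by have [] := set_mem (valP x). Qed.

Lemma bi_distxx x : bi_dist x x = 0.
Proof. exact: (wsup_distxx 0 bi_weight_ge1 (bi_space_I x)). Qed.

Lemma bi_dist_positivity x y : bi_dist x y = 0 -> x = y.
Proof.
move=> xy; apply: val_inj.
exact: (wsup_dist_positivity bi_weight_ge1 (bi_space_I x) (bi_space_I y) xy).
Qed.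

Lemma bi_dist_sym x y : bi_dist x y = bi_dist y x.
Proof. exact: wsup_dist_sym. Qed.

Lemma bi_dist_triangle y x z : bi_dist x z <= bi_dist x y + bi_dist y z.
Proof.
exact: (wsup_dist_triangle 0 bi_weight_ge1
  (bi_space_I x) (bi_space_I y) (bi_space_I z)).
Qed.

HB.instance Definition _ := isMetric.Build R bi_space
  bi_distxx bi_dist_positivity bi_dist_sym bi_dist_triangle.

Lemma bi_shift_subproof x : (fun i => val x (i + 1)) \in bi_space_set.
Proof.
have [xI xF] := set_mem (valP x).
by apply/mem_set; split => i; [exact: xI|exact: xF].
Qed.

Definition bi_shift x : bi_space := SigSub (bi_shift_subproof x).

End two_sided_system.

Definition NC {R : realType} (r rho : R) : Prop :=
  [/\ 0 < r, r < 1, 1 < rho &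
    forall k l : int, r ^ k = rho ^ l <-> k = 0 /\ l = 0].

Section LF_relations.
Context {R : realType} (n : nat) (omega : 'I_n -> R).

(* The slopes omega_1, ..., omega_n are omega 0, ..., omega (n - 1), so that  *)
(* the indices of value 0 and 1 are those of omega_1 and omega_2.             *)
Definition LF_inducing : Prop :=
  [/\ (2 <= n)%N, forall j, 0 < omega j &
    forall i j : 'I_n, i = 0%N :> nat -> j = 1%N :> nat ->
      [/\ omega i < 1, 1 < omega j & NC (omega i) (omega j)]].

Definition F_Omega : set (R * R) :=
  \bigcup_(j : 'I_n) [set p | [/\ `[0, 1]%classic p.1, `[0, 1]%classic p.2 &
                                p.2 = omega j * p.1]].

Definition slope_products (M : nat) : set R :=
  [set \prod_(i < n) omega i ^+ m i | m in
     [set m : 'I_n -> nat | (\sum_(i < n) m i)%N = M]].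

End LF_relations.

(* Main.v *)
(* A slope word with product 1 makes p, the running product of slopes along its *)
(* periodic repetition, a periodic two-sided sequence, so t * p is an orbit for *)
(* every t in a whole interval.  Letting t drift slowly from 1/2 to 1 gives a   *)
(* pseudo-orbit.  Since there are only finitely many slopes and p is bounded    *)
(* away from 0, an orbit following it closely must use exactly the same slopes, *)
(* hence is c * p for a constant c, and no c is close to both 1/2 and 1.        *)

Require Import Defs.
From mathcomp Require Import all_boot all_order all_algebra.
From mathcomp Require Import all_classical all_reals all_analysis.
From mathcomp Require Import ring lra.
Import Order.TTheory GRing.Theory Num.Theory.
Local Open Scope classical_set_scope.
Local Open Scope ring_scope.

Lemma finite_family_lbound {R : realFieldType} {I : finType} {P : pred I}
    {f : I -> R} :
  (forall i, P i -> 0 < f i) ->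
  exists2 g : R, 0 < g & forall i, P i -> g <= f i.
Proof.
move=> f0; exists (\big[Order.min/1]_(i | P i) f i).
  by elim/big_ind : _ => // x y x0 y0; rewrite lt_min x0.
by move=> i Pi; exact: bigmin_le_cond.
Qed.

Lemma finite_family_ubound {R : realFieldType} {I : finType} (f : I -> R) :
  exists2 g : R, 0 < g & forall i, f i <= g.
Proof.
exists (\big[Order.max/1]_i f i); last by move=> i; exact: le_bigmax.
exact: lt_le_trans ltr01 (bigmax_ge_id _ _ _ _).
Qed.

Lemma slope_word {R : realType} {n : nat} {omega : 'I_n -> R}
    {M : nat} {c : R} :
  slope_products omega M c ->
  exists2 s : seq 'I_n, size s = M & \prod_(i <- s) omega i = c.
Proof.
move=> [m /= mM <-].
exists (flatten [seq nseq (m i) i | i <- enum 'I_n]).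
  rewrite size_flatten /shape -map_comp -mM sumnE big_map big_enum /=.
  by apply: eq_bigr => i _; rewrite size_nseq.
rewrite big_flatten big_map big_enum /=; apply: eq_bigr => i _.
by rewrite big_nseq iter_mulr mulr1.
Qed.

Lemma periodic_slope_sequence {R : realType} {n : nat} {omega : 'I_n -> R}
    {M : nat} :
  (forall j, 0 < omega j) -> (0 < M)%N -> slope_products omega M 1 ->
  exists p : int -> R, exists2 q : R, 0 < q &
    (forall i, q <= p i <= 1) /\
    (forall i, exists j, p (i + 1) = omega j * p i).
Proof.
move=> omega0 M0 /slope_word[s sM s1].
pose run (r : nat) : R := \prod_(i <- take r s) omega i.
have run0 r : 0 < run r by apply: prodr_gt0 => i _.
have runM : run M = 1 by rewrite /run -sM take_size.
have [x0 _] : exists x0 : 'I_n, x0 \in s.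
  case: s sM {s1 run run0 runM} => [|x0 s _]; first by case: M M0.
  by exists x0; rewrite mem_head.
have runS r : (r < M)%N -> run r.+1 = omega (nth x0 s r) * run r.
  by move=> rM; rewrite /run (take_nth x0) ?sM// -cats1 big_cat big_seq1 mulrC.
have [B B0 runB] := finite_family_ubound (fun r : 'I_M => run r).
have [g g0 grun] := finite_family_lbound (P := xpredT)
  (fun (r : 'I_M) _ => run0 r).
pose idx (i : int) := `|(i %% M)%Z|%N.
have idxE i : (i %% M)%Z = idx i :> int.
  by rewrite /idx gez0_abs// modz_ge0// -lt0n.
have idxM i : (idx i < M)%N by rewrite -ltz_nat -idxE ltz_pmod.
have idxS i : idx (i + 1) = ((idx i).+1 %% M)%N.
  by rewrite {1}/idx -modzDml (idxE i) addrC -intS modz_nat.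
exists (fun i => run (idx i) / B), (g / B); first by rewrite divr_gt0.
split=> [i|i].
  rewrite ler_pM2r ?invr_gt0// (grun (Ordinal (idxM i)))//=.
  by rewrite ler_pdivrMr// mul1r (runB (Ordinal (idxM i))).
exists (nth x0 s (idx i)); rewrite mulrA -runS// idxS; congr (_ / _).
have := idxM i; rewrite leq_eqVlt => /orP[/eqP ->|iM].
  by rewrite modnn runM /run take0 big_nil.
by rewrite modn_small.
Qed.

Lemma slow_drift {R : realType} {eta : R} : 0 < eta ->
  exists t : nat -> R, [/\ forall k, 2^-1 <= t k <= 1,
    forall k, `|t k - t k.+1| <= eta, t 0%N = 2^-1 & exists K, t K = 1].
Proof.
move=> eta0; exists (fun k => Num.min 1 (2^-1 + eta * k%:R)).
split=> [k|k||].
- have : 0 <= eta * k%:R by rewrite mulr_ge0// ltW.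
  by rewrite minEle; case: ifPn => ? ?; lra.
- rewrite -[k.+1%:R]natr1 mulrDr mulr1 !minEle.
  by case: ifPn => ?; case: ifPn => ?; rewrite ler_norml; lra.
- by rewrite mulr0 addr0 minEle; case: ifPn => ?; lra.
exists (Num.truncn eta^-1).+1; apply/min_idPl.
have := truncnS_gt eta^-1; rewrite -(ltr_pM2l eta0) mulfV ?gt_eqF//.
lra.
Qed.

Lemma drift_not_shadowing {R : realType} {Y : metricType R} {f : Y -> Y}
    {proj : Y -> R} {n : nat} {omega : 'I_n -> R} {p : nat -> R} {q : R} :
  (forall j, 0 < omega j) -> 0 < q -> (forall k, q <= p k <= 1) ->
  (forall k, exists j, p k.+1 = omega j * p k) ->
  (forall y z, `|proj y - proj z| <= 2 * mdist y z) ->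
  (forall y, exists j, proj (f y) = omega j * proj y) ->
  (forall t : nat -> R, (forall k, 2^-1 <= t k <= 1) ->
    exists x : nat -> Y, (forall k, proj (x k) = t k * p k) /\
      (forall k, mdist (f (x k)) (x k.+1) <= `|t k - t k.+1|)) ->
  ~ shadowing_property f.
Proof.
move=> omega0 q0 pq pS projL projf emb shad.
have [W W0 omegaW] := finite_family_ubound omega.
have [g g0 gapP] : exists2 g : R, 0 < g &
    forall i j, omega i != omega j -> g <= `|omega i - omega j|.
  have [|g g0 gP] := @finite_family_lbound R ('I_n * 'I_n)%type
    (fun ij => omega ij.1 != omega ij.2)
    (fun ij => `|omega ij.1 - omega ij.2|).
    by move=> [i j] /= ij; rewrite normr_gt0 subr_eq0.
  by exists g => // i j ij; exact: (gP (i, j)).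
pose e := Num.min (q / 16) (g * q / (16 * (1 + W))).
have W1 : 0 < 16 * (1 + W) by lra.
have e0 : 0 < e by rewrite lt_min !divr_gt0// mulr_gt0.
have eq : 16 * e <= q.
  by have : e <= q / 16 by [rewrite ge_min lexx]; lra.
have eg : e * (16 * (1 + W)) <= g * q.
  by rewrite -ler_pdivlMr// ge_min lexx orbT.
have [d d0 dP] := shad _ e0.
have eta0 : 0 < Num.min e (d / 2) by rewrite lt_min e0 divr_gt0.
have [t [t01 tS t0 [K tK]]] := slow_drift eta0.
have [x [xE xS]] := emb t t01.
have xd : pseudo_orbit f d x.
  move=> k; apply: (le_lt_trans (xS k)); apply: (le_lt_trans (tS k)).
  have : Num.min e (d / 2) <= d / 2 by rewrite ge_min lexx orbT.
  lra.
have [y yx] := dP x xd.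
pose u k := proj (iter k f y).
have ux k : `|u k - t k * p k| < 2 * e.
  by rewrite -xE (le_lt_trans (projL _ _))// ltr_pM2l.
have ratioS k : u k.+1 * p k = u k * p k.+1.
  have [j uj] := projf (iter k f y); have [i pi] := pS k.
  rewrite -iterS -/(u _) -/(u _) in uj.
  suff ij : omega i = omega j by rewrite uj pi ij mulrCA mulrA.
  apply/eqP; apply/negPn/negP => /gapP gij.
  have /andP[qp p1] := pq k; have /andP[_ p1'] := pq k.+1.
  have := ux k; have := ux k.+1; have := tS k; have /andP[t1 _] := t01 k.
  rewrite distrC uj !ltr_norml => tk /andP[a1 a2] /andP[b1 b2].
  have uq : q / 2 - 2 * e <= u k by nra.
  have {}tk : `|t k.+1 - t k| <= e by rewrite (le_trans tk)// ge_min lexx.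
  have small : `|(omega i - omega j) * u k| <= 3 * e + 2 * e * W.
    have -> : (omega i - omega j) * u k = omega i * (u k - t k * p k)
        + (t k - t k.+1) * p k.+1 + (t k.+1 * p k.+1 - omega j * u k).
      by rewrite pi; ring.
    have c1 : `|omega i * (u k - t k * p k)| <= 2 * e * W.
      by rewrite normrM gtr0_norm// mulrC ler_pM// ltW.
    have c2 : `|(t k - t k.+1) * p k.+1| <= e.
      have p0' : 0 <= p k.+1 by have /andP[] := pq k.+1; lra.
      by rewrite normrM distrC (ger0_norm p0'); nra.
    have c3 : `|t k.+1 * p k.+1 - omega j * u k| <= 2 * e.
      by rewrite ler_norml; lra.
    apply: le_trans (ler_normD _ _) _.
    have := lerD (le_trans (ler_normD _ _) (lerD c1 c2)) c3.
    lra.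
  have u0 : 0 <= u k by lra.
  rewrite normrM (ger0_norm u0) in small.
  have : g * u k <= 3 * e + 2 * e * W.
    by apply: le_trans small; exact: ler_wpM2r.
  have : g * (q * (3 / 8)) <= g * u k by rewrite ler_pM2l//; lra.
  have : 0 < e * W by exact: mulr_gt0.
  lra.
have p0 k : 0 < p k by have /andP[] := pq k; lra.
have ratio k : u k * p 0%N = u 0%N * p k.
  elim: k => // k IHk; apply: (mulIf (lt0r_neq0 (p0 k))).
  by rewrite mulrAC ratioS mulrAC IHk mulrAC.
have /andP[q0p _] := pq 0%N; have /andP[qKp _] := pq K.
have := ux 0%N; have := ux K; have := ratio K.
rewrite t0 tK !ltr_norml => rK /andP[a1 _] /andP[_ b2].
have : p 0%N * (u K - p K) > p 0%N * - (p K / 8) by rewrite ltr_pM2l//; lra.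
have : p K * (u 0%N - p 0%N / 2) < p K * (p 0%N / 8) by rewrite ltr_pM2l//; lra.
have := mulr_gt0 (p0 0%N) (p0 K).
nra.
Qed.

Section systems.
Context {R : realType} {n : nat} {omega : 'I_n -> R}.
Context {p : int -> R} {q : R}.
Hypothesis omega_gt0 : forall j, 0 < omega j.
Hypothesis q_gt0 : 0 < q.
Hypothesis p_bound : forall i, q <= p i <= 1.
Hypothesis p_slope : forall i, exists j, p (i + 1) = omega j * p i.

Lemma scaled_in_unit c i : 2^-1 <= c <= 1 -> `[0, 1]%classic (c * p i).
Proof.
move=> /andP[c0 c1]; have /andP[qp p1] := p_bound i.
have p0 : 0 <= p i by apply: le_trans qp; exact: ltW.
by rewrite /= in_itv /= mulr_ge0 ?mulr_ile1 //; lra.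
Qed.

Lemma scaled_step c i : 2^-1 <= c <= 1 ->
  F_Omega omega (c * p i, c * p (i + 1)).
Proof.
move=> c01; have [j pj] := p_slope i; exists j => //=.
by split; [exact: scaled_in_unit.. | rewrite pj mulrCA].
Qed.

Lemma F_Omega_slope a b : F_Omega omega (a, b) -> exists j, b = omega j * a.
Proof. by move=> [j _ [_ _ /= ->]]; exists j. Qed.

Lemma scaled_dist c c' i w : 1 <= w ->
  `|c * p i - c' * p i| / w <= `|c - c'|.
Proof.
move=> w1; have w0 : 0 < w by lra.
have /andP[qp p1] := p_bound i.
have p0 : 0 <= p i by apply: le_trans qp; exact: ltW.
rewrite ler_pdivrMr// -mulrBl normrM ler_pM ?normr_ge0//.
by rewrite (ger0_norm p0); lra.
Qed.

Lemma bi_not_shadowing : ~ shadowing_property (@bi_shift R (F_Omega omega)).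
Proof.
refine (drift_not_shadowing (f := @bi_shift R (F_Omega omega))
  (proj := fun y => val y 0) (p := fun k => p k%:Z)
  omega_gt0 q_gt0 _ _ _ _ _) => // [k|y z|y|t t01].
- by rewrite -addn1 PoszD; exact: p_slope.
- have := wsup_dist_ge bi_weight_ge1 0 (bi_space_I y) (bi_space_I z).
  rewrite /bi_weight expr0 divr1 => /le_trans; apply.
  by have d0 := mdist_ge0 y z; apply: ler_peMl; [exact: d0|rewrite ler1n].
- by have [_ yF] := set_mem (valP y); exact: F_Omega_slope (yF 0).
have xP k : (fun i => t k * p (k%:Z + i)) \in bi_space_set (F_Omega omega).
  apply/mem_set; split => i; first exact: scaled_in_unit.
  by rewrite addrA; exact: scaled_step.
exists (fun k => SigSub (xP k)); split => k /=; first by rewrite addr0.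
apply: (wsup_dist_le 0) => i /=.
rewrite -[k.+1]addn1 PoszD addrAC -addrA; exact/scaled_dist/bi_weight_ge1.
Qed.

Lemma fwd_not_shadowing : ~ shadowing_property (@fwd_shift R (F_Omega omega)).
Proof.
refine (drift_not_shadowing (f := @fwd_shift R (F_Omega omega))
  (proj := fun y => val y 0%N) (p := fun k => p k%:Z)
  omega_gt0 q_gt0 _ _ _ _ _) => // [k|y z|y|t t01].
- by rewrite -addn1 PoszD; exact: p_slope.
- have := wsup_dist_ge fwd_weight_ge1 0%N (fwd_space_I y) (fwd_space_I z).
  by rewrite /fwd_weight expr1 ler_pdivrMr// mulrC.
- by have [_ yF] := set_mem (valP y); exact: F_Omega_slope (yF 0%N).
have xP k :
    (fun i : nat => t k * p (k + i)%N) \in fwd_space_set (F_Omega omega).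
  apply/mem_set; split => i; first exact: scaled_in_unit.
  by rewrite addnS -addn1 PoszD; exact: scaled_step.
exists (fun k => SigSub (xP k)); split => k /=; first by rewrite addn0.
apply: (wsup_dist_le 0%N) => i /=.
rewrite addnS -addSn; exact/scaled_dist/fwd_weight_ge1.
Qed.

End systems.

Theorem proposition5p27 (R : realType) (n : nat) (omega : 'I_n -> R)
    (hOmega : LF_inducing omega)
    (hA : exists M : nat, (0 < M)%N /\ slope_products omega M 1) :
  ~ shadowing_property (@bi_shift R (F_Omega omega)) /\
  ~ shadowing_property (@fwd_shift R (F_Omega omega)).
Proof.
have [_ omega0 _] := hOmega; have [M [M0 M1]] := hA.
have [p [q q0 [pq pS]]] := periodic_slope_sequence omega0 M0 M1.
split; [exact: (bi_not_shadowing omega0 q0 pq pS)|].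
exact: (fwd_not_shadowing omega0 q0 pq pS).
Qed.
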